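(* Let $N \ge 1$, let $G_N$ be the divisibility graph on $X_N=\{1,\dots,N\}$, and let $s,t \in X_N$ be distinct vertices that are not adjacent in $G_N$. Let $d(s,t)=\gcd(s,t)$ and let $\sigma_0(m)$ denote the number of positive divisors of $m$. Then the number $g_{st}$ of geodesic (shortest) paths between $s$ and $t$ in $G_N$ is $$g_{st} = \sigma_0\big(d(s,t)\big) + \left\lfloor \frac{N}{st/d(s,t)} \right\rfloor.$$
   Context: The divisibility graph $G_N$ is the simple undirected graph with vertex set $X_N=\{1,\dots,N\}$, in which two distinct vertices $i \ne j$ are adjacent if and only if $i$ divides $j$ or $j$ divides $i$ (no loops). A geodesic path between two vertices is a path of minimum length between them. $\lfloor x \rfloor$ denotes the floor of $x$. (The paper writes $s(\cdot)$ for the divisor-counting function; here it is written $\sigma_0$ to avoid a clash with the vertex name $s$.) *)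

(* Defs.v *)
From mathcomp Require Import all_boot.

Set Implicit Arguments.
Unset Strict Implicit.
Unset Printing Implicit Defensive.

Definition vertex (N : nat) : predArgType := seq_sub (index_iota 1 N.+1).

Coercion vertex_val N (x : vertex N) : nat := ssval x.

Definition divgraph (N : nat) : rel (vertex N) :=
  fun i j => (i != j) && ((i %| j) || (j %| i)).

(* As in path.v, a path from s is given by the sequence p of the vertices that
   follow s; its length (number of edges) is therefore size p. *)
Definition is_path_between (T : finType) (e : rel T) (s t : T) (p : seq T) :
    bool :=
  [&& path e s p, last s p == t & uniq (s :: p)].

(* A path has pairwise distinct vertices, so size p < #|T|: letting p range
   over the finite type #|T|.-bseq T loses no path, see geodesicP. *)
Definition geodesic (T : finType) (e : rel T) (s t : T) (p : #|T|.-bseq T) :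
    bool :=
  is_path_between e s t p &&
  [forall q : #|T|.-bseq T, is_path_between e s t q ==> (size p <= size q)].

Definition num_geodesics (T : finType) (e : rel T) (s t : T) : nat :=
  #|[set p : #|T|.-bseq T | geodesic e s t p]|.

Lemma is_path_between_size (T : finType) (e : rel T) s t p :
  is_path_between e s t p -> size p <= #|T|.
Proof.
by case/and3P=> _ _ /card_uniqP /= Up; rewrite ltnW // -Up max_card.
Qed.

Lemma geodesicP (T : finType) (e : rel T) s t (p : #|T|.-bseq T) :
  reflect (is_path_between e s t p /\
           forall q : seq T, is_path_between e s t q -> size p <= size q)
          (geodesic e s t p).
Proof.
apply: (iffP andP) => -[sp minp]; split=> //.
  move=> q sq; have szq := is_path_between_size sq.
  by move/forallP/(_ (Bseq szq))/implyP: minp; apply.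
by apply/forallP=> q; apply/implyP; apply: minp.
Qed.

Definition sigma0 (m : nat) : nat := size (divisors m).

(* Main.v *)
Require Import Defs.
From mathcomp Require Import all_boot.

Set Implicit Arguments.
Unset Strict Implicit.
Unset Printing Implicit Defensive.

(** Two distinct non-adjacent vertices [s] and [t] are both adjacent to [1], so
    the geodesics between them are the paths of length 2, one for each common
    neighbour [v].  Since neither of [s] and [t] divides the other, such a [v]
    divides both, that is, divides their gcd, or is a multiple of both, that
    is, a multiple of their lcm [s t / d(s, t)], and not both at once. *)

Lemma is_path_between2 (T : finType) (e : rel T) (s t v : T) :
  irreflexive e -> s != t -> e s v -> e v t -> is_path_between e s t [:: v; t].
Proof.
move=> e_irr st sv vt; rewrite /is_path_between /= sv vt eqxx !inE.
rewrite negb_or st !andbT /=.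
apply/andP; split; first by apply: contraTneq sv => ->; rewrite e_irr.
by apply: contraTneq vt => ->; rewrite e_irr.
Qed.

Lemma size_path_between_gt1 (T : finType) (e : rel T) (s t : T) (p : seq T) :
  s != t -> ~~ e s t -> is_path_between e s t p -> 1 < size p.
Proof.
case: p => [|v [|w p]] //= st nst /and3P[/= sv /eqP vt _].
  by rewrite vt eqxx in st.
by rewrite -vt (andP sv).1 in nst.
Qed.

(** The path through [u] bounds every geodesic by length 2 and non-adjacency forbids a shorter one,
    so a geodesic is determined by its middle vertex. *)
Lemma num_geodesics_common_neighbours (T : finType) (e : rel T) (s t u : T) :
  irreflexive e -> s != t -> ~~ e s t -> e s u -> e u t ->
  num_geodesics e s t = #|[set v | e s v && e v t]|.
Proof.
move=> e_irr st nst su ut.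
have shape (p : #|T|.-bseq T) : geodesic e s t p ->
    exists v, [/\ p = [:: v; t] :> seq T, e s v & e v t].
  case/geodesicP=> path_p /(_ _ (is_path_between2 e_irr st su ut)) le_p2.
  have := size_path_between_gt1 st nst path_p.
  case/and3P: path_p le_p2; case: (bseqval p) => [|v [|w [|]]] //=.
  by case/and3P=> sv vw _ /eqP <- *; exists v.
(* [head s] picks the middle vertex; its default [s] is never reached, since a geodesic has size
   2. *)
rewrite /num_geodesics -(@card_in_imset _ _ (fun p : #|T|.-bseq T => head s p)).
  congr #|pred_of_set _|; apply/setP=> v; rewrite inE; apply/imsetP/andP.
    by case=> p; rewrite inE => /shape[w [-> sw wt]] ->.
  case=> sv vt; have path_v := is_path_between2 e_irr st sv vt.
  exists (Bseq (is_path_between_size path_v)) => //; rewrite inE.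
  by apply/geodesicP; split=> // q; apply: size_path_between_gt1.
move=> p q; rewrite !inE => /shape[v [pE _ _]] /shape[w [qE _ _]].
by rewrite pE qE /= => vw; apply: val_inj; rewrite /= pE qE vw.
Qed.

Lemma divgraph_irr N : irreflexive (@divgraph N).
Proof. by move=> v; rewrite /divgraph eqxx. Qed.

Lemma card_vertex N (P : pred nat) :
  #|[set v : vertex N | P v]| = count P (index_iota 1 N.+1).
Proof.
rewrite cardsE cardE size_filter -enumT -(count_map (@vertex_val N) P).
apply/permP/uniq_perm; rewrite ?iota_uniq //.
  by rewrite map_inj_uniq ?enum_uniq // => v w; apply: val_inj.
move=> n; apply/mapP/idP => [[v _ ->]|n_in]; first exact: valP.
by exists (SeqSub n_in); rewrite ?mem_enum.
Qed.

(** The bound [d <= N] keeps every divisor of [d] inside the range. *)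
Lemma count_dvdn_sigma0 d N :
  0 < d <= N -> count (dvdn^~ d) (index_iota 1 N.+1) = sigma0 d.
Proof.
case/andP=> d_gt0 le_dN; rewrite -size_filter; apply/perm_size/uniq_perm.
- by rewrite filter_uniq ?iota_uniq.
- exact: divisors_uniq.
move=> n; rewrite mem_filter mem_index_iota -dvdn_divisors //.
case n_d: (n %| d) => //=; rewrite (dvdn_gt0 d_gt0 n_d) ltnS.
exact: leq_trans (dvdn_leq d_gt0 n_d) le_dN.
Qed.

Lemma count_multiples l N : count (dvdn l) (index_iota 1 N.+1) = N %/ l.
Proof. by rewrite divn_count_dvd -sum1_count big_mkcond. Qed.

Lemma common_neighbour_divgraph N (s t v : vertex N) :
  ~~ (s %| t) -> ~~ (t %| s) ->
  divgraph s v && divgraph v t = (v %| gcdn s t) || (lcmn s t %| v).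
Proof.
move=> nst nts; rewrite /divgraph dvdn_gcd dvdn_lcm.
(* For [v = s] or [v = t] the left side fails for lack of loops; the right side would make one of
   [s], [t] divide the other. *)
have [<-|_] /= := eqVneq s v; first by rewrite (negPf nst) (negPf nts) !andbF.
have [->|_] /= := eqVneq v t; first by rewrite (negPf nst) (negPf nts) !andbF.
case sv: (s %| v); case vt: (v %| t); rewrite ?andbF ?andbT ?orbF ?orbT //=.
  (* The mixed chains, [s] to [v] to [t] here and its reverse below, are excluded by
     transitivity. *)
  by rewrite (dvdn_trans sv vt) in nst.
case tv: (t %| v); case vs: (v %| s) => //=.
by rewrite (dvdn_trans tv vs) in nts.
Qed.

Theorem theorem4 (N : nat) (hN : 1 <= N) (s t : vertex N)
    (hst : s != t) (hadj : ~~ divgraph s t) :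
  num_geodesics (@divgraph N) s t
    = sigma0 (gcdn s t) + N %/ ((s * t) %/ gcdn s t).
Proof.
have /norP[nst nts] : ~~ ((s %| t) || (t %| s)).
  by move: hadj; rewrite /divgraph hst.
have /andP[s_gt0 s_leN] : 0 < s <= N.
  by have := valP s; rewrite mem_index_iota ltnS.
(* The vertex 1 divides the gcd, so it serves as the common neighbour [u]. *)
have in1 : 1 \in index_iota 1 N.+1 by rewrite mem_index_iota ltnS.
have /andP[s1 t1] : divgraph s (SeqSub in1) && divgraph (SeqSub in1) t.
  by rewrite common_neighbour_divgraph // dvd1n.
rewrite (num_geodesics_common_neighbours (@divgraph_irr N) hst hadj s1 t1).
set P := dvdn^~ (gcdn s t); set Q := dvdn (lcmn s t).
have -> : [set v | divgraph s v && divgraph v t] =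
    [set v : vertex N | predU P Q v].
  by apply/setP=> v; rewrite !inE common_neighbour_divgraph.
rewrite card_vertex.
(* A multiple of the lcm that divides the gcd would force [s] to divide [t]. *)
have disj : count (predI P Q) (index_iota 1 N.+1) = 0.
  rewrite -[RHS](count_pred0 (index_iota 1 N.+1)); apply: eq_count => v /=.
  apply: contraNF nst; rewrite /P /Q dvdn_gcd dvdn_lcm.
  by case/andP=> /andP[_ vt] /andP[sv _]; apply: dvdn_trans sv vt.
have := count_predUI P Q (index_iota 1 N.+1).
rewrite disj addn0 => ->; rewrite count_multiples.
(* The second summands agree by conversion: [lcmn s t] unfolds to [s * t %/ gcdn s t]. *)
rewrite count_dvdn_sigma0 // gcdn_gt0 s_gt0.
exact: leq_trans (dvdn_leq s_gt0 (dvdn_gcdl s t)) s_leN.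
Qed.
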